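(* Let $Q=Q^\top\in\mathbb{R}^{n\times n}$ be positive semidefinite and $R=R^\top\in\mathbb{R}^{m\times m}$ be positive definite. Suppose that the data $(U_-,X)$ are informative for linear quadratic regulation, let $K$ be the optimal feedback gain, i.e. the matrix with $\Sigma_{i/s}\subseteq\Sigma_K^{Q,R}$, and let $P^+$ be the symmetric positive semidefinite matrix, common to all $(A,B)\in\Sigma_{i/s}$, described in the context. Define $$\mathcal{L}(P):=X_-^\top PX_--X_+^\top PX_+-X_-^\top QX_--U_-^\top RU_-.$$ The following statements hold: (i) The matrix $P^+$ is equal to the unique solution to the optimization problem $$\text{maximize }\operatorname{tr}P\quad\text{subject to}\quad P=P^\top\ge0\ \text{ and }\ \mathcal{L}(P)\le0,$$ over $P\in\mathbb{R}^{n\times n}$. (ii) There exists a right inverse $X_-^\dagger$ of $X_-$ such that $\mathcal{L}(P^+)X_-^\dagger=0$. Moreover, if $X_-^\dagger$ is a right inverse of $X_-$ satisfying $\mathcal{L}(P^+)X_-^\dagger=0$, then the optimal feedback gain is given by $K=U_-X_-^\dagger$.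
   Context: Fix positive integers $n,m,q,T_1,\dots,T_q$. Let $(A_s,B_s)\in\mathbb{R}^{n\times n}\times\mathbb{R}^{n\times m}$ be the 'true' system $x(t+1)=A_sx(t)+B_su(t)$. For $i=1,\dots,q$ let $u^i(0),\dots,u^i(T_i-1)\in\mathbb{R}^m$ and $x^i(0),\dots,x^i(T_i)\in\mathbb{R}^n$ be input/state data generated by this system, i.e. $x^i(t+1)=A_sx^i(t)+B_su^i(t)$ for $t=0,\dots,T_i-1$. Put $U^i_-=[u^i(0)\ \cdots\ u^i(T_i-1)]$, $X^i=[x^i(0)\ \cdots\ x^i(T_i)]$, $X^i_-=[x^i(0)\ \cdots\ x^i(T_i-1)]$, $X^i_+=[x^i(1)\ \cdots\ x^i(T_i)]$, and $U_-=[U^1_-\ \cdots\ U^q_-]$, $X=[X^1\ \cdots\ X^q]$, $X_-=[X^1_-\ \cdots\ X^q_-]$, $X_+=[X^1_+\ \cdots\ X^q_+]$; thus $X_+=A_sX_-+B_sU_-$. The set of systems consistent with the data is $$\Sigma_{i/s}=\Big\{(A,B)\in\mathbb{R}^{n\times n}\times\mathbb{R}^{n\times m}\ \Big|\ X_+=\begin{bmatrix}A & B\end{bmatrix}\begin{bmatrix}X_- \\ U_- \end{bmatrix}\Big\}.$$ Matrix inequalities $\ge,\le$ are in the semidefinite order. A right inverse of $X_-$ is a real matrix $X_-^\dagger$ with $X_-X_-^\dagger=I$. LQR. For a system $x(t+1)=Ax(t)+Bu(t)$, let $x_{x_0,u}$ be the state sequence with $x(0)=x_0$ and input $u$, and let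 $J(x_0,u)=\sum_{t=0}^\infty x(t)^\top Qx(t)+u(t)^\top Ru(t)$. The LQR problem is solvable for $(A,B,Q,R)$ if for every $x_0$ there is an input $u^*$ with $J(x_0,u^* )<\infty$, $\lim_{t\to\infty}x_{x_0,u^*}(t)=0$, and $J(x_0,u^* )\le J(x_0,\bar u)$ for all $\bar u$ with $\lim_{t\to\infty}x_{x_0,\bar u}(t)=0$. Known facts (discrete-time LQR theory): if $(A,B)$ is stabilizable, the discrete-time algebraic Riccati equation $P=A^\top PA-A^\top PB(R+B^\top PB)^{-1}B^\top PA+Q$ has a unique largest real symmetric solution (in the sense of $\ge$), and this solution is positive semidefinite; the LQR problem is solvable if and only if $(A,B)$ is stabilizable and every eigenvalue $\lambda$ of $A$ on the unit circle is $(Q,A)$-observable, i.e. $\operatorname{rank}\begin{bmatrix}A-\lambda I \\ Q \end{bmatrix}=n$; in that case, with $P^+_{(A,B)}$ the largest solution, the optimal input is unique for every $x_0$ and generated by $u=Kx$ with $K=-(R+B^\top P^+_{(A,B)}B)^{-1}B^\top P^+_{(A,B)}A$, and $A+BK$ is stable (all eigenvalues in the open unit disk). This $K$ is called the optimal feedback gain for $(A,B,Q,R)$. Define $\Sigma_K^{Q,R}=\{(A,B)\mid$ the LQR problem is solvable for $(A,B,Q,R)$ and $K$ is the optimal feedback gain for $(A,B,Q,R)\}$. The data $(U_-,X)$ are informative for linear quadratic regulation (for given $Q,R$) if there exists $K$ with $\Sigma_{i/s}\subseteq\Sigma_K^{Q,R}$. The matrix $P^+$: when the data are informative for linear quadratic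 regulation and $\Sigma_{i/s}\subseteq\Sigma_K^{Q,R}$, there exist a matrix $M$ and a symmetric positive semidefinite matrix $P^+$ (a separate lemma of the paper) such that for all $(A,B)\in\Sigma_{i/s}$: $M=A+BK$; $P^+=A^\top P^+A-A^\top P^+B(R+B^\top P^+B)^{-1}B^\top P^+A+Q$; $P^+-M^\top P^+M=K^\top RK+Q$; and $K=-(R+B^\top P^+B)^{-1}B^\top P^+A$. This is the $P^+$ in the claim. *)

(* Defs.v *)
From HB Require Import structures.
From mathcomp Require Import all_boot all_order all_algebra.
From mathcomp Require Import all_classical all_reals all_analysis.

Set Implicit Arguments.
Unset Strict Implicit.
Unset Printing Implicit Defensive.

Import Order.TTheory GRing.Theory Num.Theory.
Import numFieldNormedType.Exports.

Local Open Scope classical_set_scope.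
Local Open Scope ring_scope.

Section semidefinite_order.
Context {R : realType} {n : nat}.
Implicit Types S P : 'M[R]_n.

Definition quad S (v : 'cV[R]_n) : R := (v^T *m S *m v) 0 0.

Definition psd S := S^T = S /\ forall v, 0 <= quad S v.

Definition posdef S := S^T = S /\ forall v, v != 0 -> 0 < quad S v.

Definition mxle S P := psd (P - S).

End semidefinite_order.

Section lqr.
Context {R : realType} {n m : nat}.
Variables (A : 'M[R]_n) (B : 'M[R]_(n, m)) (Q : 'M[R]_n) (Ru : 'M[R]_m).
Implicit Types (u : nat -> 'cV[R]_m) (P : 'M[R]_n).

Fixpoint traj (x0 : 'cV[R]_n) u (t : nat) : 'cV[R]_n :=
  if t is s.+1 then A *m traj x0 u s + B *m u s else x0.

(* The terms are nonnegative when Q is positive semidefinite and Ru positive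
   definite, so that the series always has a value in [0, +oo]. *)
Definition lqr_cost x0 u : \bar R :=
  (\sum_(0 <= t <oo) (quad Q (traj x0 u t) + quad Ru (u t))%:E)%E.

Definition steers_to_zero x0 u := traj x0 u t @[t --> \oo] --> (0 : 'cV[R]_n).

Definition lqr_solvable := forall x0, exists u,
  [/\ (lqr_cost x0 u < +oo)%E,
      steers_to_zero x0 u &
      forall v, steers_to_zero x0 v -> (lqr_cost x0 u <= lqr_cost x0 v)%E].

Definition riccati P : 'M[R]_n :=
  A^T *m P *m A
  - A^T *m P *m B *m invmx (Ru + B^T *m P *m B) *m B^T *m P *m A + Q.

Definition riccati_gain P : 'M[R]_(m, n) :=
  - (invmx (Ru + B^T *m P *m B) *m B^T *m P *m A).

(* invmx is total: the membership in unitmx expresses that the inverse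
   occurring in the equation exists. *)
Definition dare_solution P :=
  [/\ P^T = P, Ru + B^T *m P *m B \in unitmx & P = riccati P].

Definition largest_dare_solution P :=
  dare_solution P /\ forall P', dare_solution P' -> mxle P' P.

Definition optimal_gain (K : 'M[R]_(m, n)) :=
  exists P, largest_dare_solution P /\ K = riccati_gain P.

End lqr.

(* The i-th experiment has horizon T i; only the inputs u i t with t < T i and
   the states x i t with t <= T i are data. *)
Section data.
Context {R : realType} {n m q : nat}.
Variables (T : 'I_q -> nat).
Variables (u : 'I_q -> nat -> 'cV[R]_m) (x : 'I_q -> nat -> 'cV[R]_n).

Definition generated_by (A : 'M[R]_n) (B : 'M[R]_(n, m)) :=
  forall (i : 'I_q) (t : nat), (t < T i)%N ->
    x i t.+1 = A *m x i t + B *m u i t.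

Definition Uminus : 'M[R]_(m, \sum_(i < q) T i) :=
  \mxrow_(i < q) \matrix_(a < m, t < T i) u i t a 0.

Definition Xminus : 'M[R]_(n, \sum_(i < q) T i) :=
  \mxrow_(i < q) \matrix_(a < n, t < T i) x i t a 0.

Definition Xplus : 'M[R]_(n, \sum_(i < q) T i) :=
  \mxrow_(i < q) \matrix_(a < n, t < T i) x i t.+1 a 0.

Definition Sigma_is : set ('M[R]_n * 'M[R]_(n, m)) :=
  [set AB | Xplus = row_mx AB.1 AB.2 *m col_mx Xminus Uminus].

Definition Sigma_gain (Q : 'M[R]_n) (Ru : 'M[R]_m) (K : 'M[R]_(m, n)) :
    set ('M[R]_n * 'M[R]_(n, m)) :=
  [set AB | lqr_solvable AB.1 AB.2 Q Ru /\ optimal_gain AB.1 AB.2 Q Ru K].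

Definition informative_lqr (Q : 'M[R]_n) (Ru : 'M[R]_m) :=
  exists K, Sigma_is `<=` Sigma_gain Q Ru K.

Definition common_riccati (Q : 'M[R]_n) (Ru : 'M[R]_m) (K : 'M[R]_(m, n))
    (P : 'M[R]_n) :=
  psd P /\ exists M : 'M[R]_n, forall A B, Sigma_is (A, B) ->
    [/\ M = A + B *m K,
        P = riccati A B Q Ru P,
        P - M^T *m P *m M = K^T *m Ru *m K + Q &
        K = riccati_gain A B Ru P].

Definition lqr_lmi (Q : 'M[R]_n) (Ru : 'M[R]_m) (P : 'M[R]_n) :
    'M[R]_(\sum_(i < q) T i) :=
  Xminus^T *m P *m Xminus - Xplus^T *m P *m Xplus
  - Xminus^T *m Q *m Xminus - Uminus^T *m Ru *m Uminus.

Definition lmi_feasible (Q : 'M[R]_n) (Ru : 'M[R]_m) (P : 'M[R]_n) :=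
  psd P /\ mxle (lqr_lmi Q Ru P) 0.

Definition trace_maximizer (Q : 'M[R]_n) (Ru : 'M[R]_m) (P : 'M[R]_n) :=
  lmi_feasible Q Ru P /\
  forall P', lmi_feasible Q Ru P' -> \tr P' <= \tr P.

End data.

(* Main.v *)
(* For a solvable LQR problem the parallelogram identity for the cost shows
   that sums of optimal inputs are optimal.  Hence the value function is a
   quadratic form V; by Bellman's principle V solves the Riccati equation, so
   V is below its largest solution P.  Completing the squares with P along an
   optimal trajectory then forces u(t) = K x(t), so that M = A + B K is stable.

   If a row annihilates [X_-; U_-], adding it to a consistent system leaves
   A + B K unchanged, so it annihilates [I; K]: hence X_- Y = I and U_- Y = K
   for some Y.  Since L(P) = - E^T (R + B^T P B) E with E = U_- - K X_-, this
   gives (ii).  For a feasible P', compressing L(P') <= 0 by Y and subtracting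
   the Lyapunov equation of P shows that D = P - P' satisfies M^T D M <= D;
   iterating and using that M is stable, D >= 0, which gives (i). *)
Require Import Defs.
From mathcomp Require Import all_boot all_order all_algebra.
From mathcomp Require Import all_classical all_reals all_analysis.
From mathcomp Require Import ring lra.

Set Implicit Arguments.
Unset Strict Implicit.
Unset Printing Implicit Defensive.

Import Order.TTheory GRing.Theory Num.Theory.
Import numFieldNormedType.Exports.
Local Open Scope classical_set_scope.
Local Open Scope ring_scope.

(** * Quadratic forms: polarization, definiteness and limits *)

Section quadratic_forms.
Context {R : realType}.

Definition bform n (S : 'M[R]_n) (v w : 'cV[R]_n) : R := (v^T *m S *m w) 0 0.

Lemma quad_bform n (S : 'M[R]_n) v : quad S v = bform S v v.
Proof. by []. Qed.

Lemma bformDl n (S : 'M[R]_n) v v' w :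
  bform S (v + v') w = bform S v w + bform S v' w.
Proof. by rewrite /bform linearD /= !mulmxDl mxE. Qed.

Lemma bformDr n (S : 'M[R]_n) v w w' :
  bform S v (w + w') = bform S v w + bform S v w'.
Proof. by rewrite /bform mulmxDr mxE. Qed.

Lemma bformZl n (S : 'M[R]_n) a v w : bform S (a *: v) w = a * bform S v w.
Proof. by rewrite /bform linearZ /= -!scalemxAl mxE. Qed.

Lemma bformZr n (S : 'M[R]_n) a v w : bform S v (a *: w) = a * bform S v w.
Proof. by rewrite /bform -!scalemxAr mxE. Qed.

Lemma bformNl n (S : 'M[R]_n) v w : bform S (- v) w = - bform S v w.
Proof. by rewrite -scaleN1r bformZl mulN1r. Qed.

Lemma bformNr n (S : 'M[R]_n) v w : bform S v (- w) = - bform S v w.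
Proof. by rewrite -scaleN1r bformZr mulN1r. Qed.

Lemma bformC n (S : 'M[R]_n) v w : S^T = S -> bform S v w = bform S w v.
Proof.
move=> Ssym; rewrite /bform -[in LHS](trmxK (v^T *m S *m w)) mxE.
by rewrite !trmx_mul Ssym trmxK mulmxA.
Qed.

Lemma bformDm n (S S' : 'M[R]_n) v w :
  bform (S + S') v w = bform S v w + bform S' v w.
Proof. by rewrite /bform mulmxDr mulmxDl mxE. Qed.

Lemma bformNm n (S : 'M[R]_n) v w : bform (- S) v w = - bform S v w.
Proof. by rewrite /bform mulmxN mulNmx mxE. Qed.

Lemma bform_mulmx n k l (S : 'M[R]_k) (N : 'M[R]_(k, n)) (N' : 'M[R]_(k, l)) v w :
  (v^T *m (N^T *m S *m N') *m w) 0 0 = bform S (N *m v) (N' *m w).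
Proof. by rewrite /bform trmx_mul !mulmxA. Qed.

Lemma bform_delta n (S : 'M[R]_n) i j :
  bform S (delta_mx i 0) (delta_mx j 0) = S i j.
Proof. by rewrite /bform trmx_delta -rowE -colE !mxE. Qed.

Lemma quadD n (S : 'M[R]_n) v w : S^T = S ->
  quad S (v + w) = quad S v + quad S w + 2 * bform S v w.
Proof.
move=> Ssym; rewrite !quad_bform bformDl !bformDr [bform S w v]bformC //.
by ring.
Qed.

Lemma quad_parallelogram n (S : 'M[R]_n) v w :
  quad S (v + w) + quad S (v - w) = 2 * quad S v + 2 * quad S w.
Proof.
by rewrite !quad_bform !(bformDl, bformDr, bformNl, bformNr); ring.
Qed.

Lemma quadZ n (S : 'M[R]_n) a v : quad S (a *: v) = a ^+ 2 * quad S v.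
Proof. by rewrite !quad_bform bformZl bformZr; ring. Qed.

Lemma quad0 n (S : 'M[R]_n) : quad S 0 = 0.
Proof. by rewrite /quad mulmx0 mxE. Qed.

Lemma quad0m n (v : 'cV[R]_n) : quad 0 v = 0.
Proof. by rewrite /quad mulmx0 mul0mx mxE. Qed.

Lemma quadDm n (S S' : 'M[R]_n) v : quad (S + S') v = quad S v + quad S' v.
Proof. exact: bformDm. Qed.

Lemma quadBm n (S S' : 'M[R]_n) v : quad (S - S') v = quad S v - quad S' v.
Proof. by rewrite quadDm [X in _ + X]bformNm. Qed.

Lemma quad_mulmx n k (S : 'M[R]_k) (N : 'M[R]_(k, n)) v :
  quad (N^T *m S *m N) v = quad S (N *m v).
Proof. exact: bform_mulmx. Qed.

Lemma sym_mulmx n k (S : 'M[R]_k) (N : 'M[R]_(k, n)) : S^T = S ->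
  (N^T *m S *m N)^T = N^T *m S *m N.
Proof. by move=> Ssym; rewrite !trmx_mul trmxK Ssym mulmxA. Qed.

(** Polarization at sums of two basis vectors recovers every entry, the diagonal ones included. *)
Lemma sym_quad_inj n (S S' : 'M[R]_n) : S^T = S -> S'^T = S' ->
  (forall v, quad S v = quad S' v) -> S = S'.
Proof.
move=> Ssym S'sym eqSS'; apply/matrixP => i j.
have := eqSS' (delta_mx i 0 + delta_mx j 0).
by rewrite !quadD // !eqSS' !bform_delta; lra.
Qed.

Lemma posdef_unitmx n (S : 'M[R]_n) : posdef S -> S \in unitmx.
Proof.
move=> [Ssym Spos]; rewrite -row_free_unit -kermx_eq0; apply/eqP/row_matrixP => i.
rewrite row0; apply: trmx_inj; rewrite trmx0; apply/eqP/negPn/negP => /Spos.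
suff -> : quad S (row i (kermx S))^T = 0 by rewrite ltxx.
by rewrite /quad trmxK -row_mul mulmx_ker row0 mul0mx mxE.
Qed.

Lemma posdef_addr n m (S : 'M[R]_m) (P : 'M[R]_n) (B : 'M[R]_(n, m)) :
  posdef S -> psd P -> posdef (S + B^T *m P *m B).
Proof.
move=> [Ssym Spos] [Psym Ppos]; split.
  by rewrite linearD /= sym_mulmx // Ssym.
by move=> v v0; rewrite quadDm quad_mulmx ltr_pwDl// Spos.
Qed.

Lemma posdef_quad_ge0 n (S : 'M[R]_n) v : posdef S -> 0 <= quad S v.
Proof.
move=> [_ Spos]; have [->|/Spos/ltW//] := eqVneq v 0; by rewrite quad0.
Qed.

Lemma posdef_quad_eq0 n (S : 'M[R]_n) v : posdef S -> quad S v <= 0 -> v = 0.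
Proof.
move=> [_ Spos]; have [//|/Spos h] := eqVneq v 0; by rewrite leNgt h.
Qed.

Lemma psd_trace_ge0 n (S : 'M[R]_n) : psd S -> 0 <= \tr S.
Proof.
move=> [_ Spos]; apply: sumr_ge0 => i _.
by rewrite -bform_delta; exact: Spos.
Qed.

(* When [S j j = 0], [t |-> quad S (e_i + t e_j)] is affine in [t] and
   nonnegative, hence constant. *)
Lemma psd_diag_eq0 n (S : 'M[R]_n) i j : psd S -> S j j = 0 -> S i j = 0.
Proof.
move=> [Ssym Spos] Sjj; apply/eqP/negPn/negP => Sij.
(* The parameter is chosen so that the affine function takes the value -1. *)
have := Spos (delta_mx i 0 + (- (S i i + 1) / (2 * S i j)) *: delta_mx j 0).
rewrite quadD // quadZ bformZr !quad_bform !bform_delta Sjj.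
set d := S i j in Sij *.
have -> : S i i + (- (S i i + 1) / (2 * d)) ^+ 2 * 0 +
   2 * (- (S i i + 1) / (2 * d) * d) = -1 by field.
by rewrite ler0N1.
Qed.

Lemma psd_trace_eq0 n (S : 'M[R]_n) : psd S -> \tr S <= 0 -> S = 0.
Proof.
move=> Spsd tr0; have S0 i : 0 <= S i i.
  by rewrite -bform_delta; exact: (proj2 Spsd).
apply/matrixP => i j; rewrite mxE; apply: psd_diag_eq0 => //.
apply/eqP; rewrite eq_le S0 andbT; apply: le_trans tr0.
by rewrite /mxtrace (bigD1 j) //= lerDl sumr_ge0.
Qed.

Lemma quad_sum n (S : 'M[R]_n) (v : 'cV[R]_n) :
  quad S v = \sum_j \sum_i v i 0 * S i j * v j 0.
Proof.
rewrite /quad mxE; apply: eq_bigr => j _; rewrite mxE mulr_suml.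
by apply: eq_bigr => i _; rewrite mxE.
Qed.

(** Both arguments may vary: [cvg_quad] fixes the matrix, [cvg_quad_limit] the vector. *)
Lemma cvg_quad_sum n (S : nat -> 'M[R]_n) (x : nat -> 'cV[R]_n)
    (S0 : 'M[R]_n) (x0 : 'cV[R]_n) :
  (forall i j, S t i j @[t --> \oo] --> S0 i j) ->
  (forall i, x t i 0 @[t --> \oo] --> x0 i 0) ->
  quad (S t) (x t) @[t --> \oo] --> quad S0 x0.
Proof.
move=> Scvg xcvg; rewrite quad_sum.
under eq_fun do rewrite quad_sum.
apply: (cvg_big add_continuous) => j _.
apply: (cvg_big add_continuous) => i _.
by apply: cvgM => //; apply: cvgM.
Qed.

Lemma cvg_quad n (S : 'M[R]_n) (x : nat -> 'cV[R]_n) (x0 : 'cV[R]_n) :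
  x t @[t --> \oo] --> x0 -> quad S (x t) @[t --> \oo] --> quad S x0.
Proof.
move=> xcvg; apply: (@cvg_quad_sum _ (fun=> S)) => [i j|i]; first exact: cvg_cst.
exact: (cvg_comp x (fun M : 'cV[R]_n => M i 0) xcvg (@coord_continuous R n 1 i 0 x0)).
Qed.

(** By polarization each entry is a combination of values of the form, so pointwise convergence of
    forms is entrywise convergence. Applied to truncated costs, this produces the value matrix. *)
Lemma cvg_quad_limit n (S : nat -> 'M[R]_n) :
  (forall N, (S N)^T = S N) -> (forall v, cvgn (fun N => quad (S N) v)) ->
  exists2 P : 'M[R]_n, P^T = P &
    forall v, quad (S N) v @[N --> \oo] --> quad P v.
Proof.
move=> Ssym Scvg.
have Sij_cvg i j : cvgn (fun N => S N i j).
  pose v : 'cV[R]_n := delta_mx i 0; pose w : 'cV[R]_n := delta_mx j 0.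
  have -> : (fun N => S N i j) = (fun N => 2^-1 *
      (quad (S N) (v + w) - quad (S N) v - quad (S N) w)).
    by apply/funext => N; rewrite quadD // bform_delta; field.
  apply: is_cvgMr; apply: is_cvgB; last exact: Scvg.
  by apply: is_cvgB; exact: Scvg.
pose P : 'M[R]_n := \matrix_(i, j) limn (fun N => S N i j).
exists P.
  apply/matrixP => i j; rewrite !mxE; suff -> : (fun N => S N j i) = (fun N => S N i j) by [].
  apply/funext => N.
  by rewrite -[in LHS]Ssym mxE.
move=> v; apply: cvg_quad_sum => [i j|i]; last exact: cvg_cst.
by rewrite mxE; exact: Sij_cvg.
Qed.

End quadratic_forms.

(** * Costs and optimal inputs of one fixed system *)

Section lqr_optimality.
Context {R : realType} {n m : nat}.
Context (A : 'M[R]_n) (B : 'M[R]_(n, m)) (Q : 'M[R]_n) (Ru : 'M[R]_m).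
Context (Q_psd : psd Q) (Ru_pd : posdef Ru).
Implicit Types (x y : 'cV[R]_n) (u v w : nat -> 'cV[R]_m) (c d : R).

Local Notation traj := (traj A B).
Local Notation steers := (steers_to_zero A B).

Definition stage_cost (x : 'cV[R]_n) (v : 'cV[R]_m) := quad Q x + quad Ru v.

Definition partial_cost x u N :=
  \sum_(0 <= t < N) stage_cost (traj x u t) (u t).

(** A real limit replaces the extended sum: an input of infinite cost has no [c], so [optimal]
    compares only with competitors of finite cost. *)
Definition has_cost x u c := partial_cost x u N @[N --> \oo] --> c.

Definition optimal x u c :=
  [/\ has_cost x u c, steers x u &
      forall v d, steers x v -> has_cost x v d -> c <= d].

Lemma stage_cost_ge0 x (v : 'cV[R]_m) : 0 <= stage_cost x v.
Proof. by apply: addr_ge0; [exact: Q_psd.2 | exact: posdef_quad_ge0]. Qed.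

Lemma partial_costS x u N :
  partial_cost x u N.+1 = partial_cost x u N + stage_cost (traj x u N) (u N).
Proof. by rewrite /partial_cost big_nat_recr. Qed.

Lemma partial_cost_nondecreasing x u : nondecreasing_seq (partial_cost x u).
Proof.
apply/nondecreasing_seqP => N.
by rewrite partial_costS lerDl stage_cost_ge0.
Qed.

Lemma partial_cost_ge0 x u N : 0 <= partial_cost x u N.
Proof. by apply: sumr_ge0 => t _; exact: stage_cost_ge0. Qed.

Lemma bounded_has_cost x u b :
  (forall N, partial_cost x u N <= b) -> exists c, has_cost x u c.
Proof.
move=> ub; apply/cvg_ex; apply: nondecreasing_is_cvgn.
  exact: partial_cost_nondecreasing.
by exists b => _ [N _ <-].
Qed.

Lemma partial_cost_le x u c N : has_cost x u c -> partial_cost x u N <= c.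
Proof.
move=> uc; rewrite -(cvg_lim _ uc)//; apply: nondecreasing_cvgn_le.
  exact: partial_cost_nondecreasing.
by apply/cvg_ex; exists c.
Qed.

Lemma has_cost_ge0 x u c : has_cost x u c -> 0 <= c.
Proof.
by move/(partial_cost_le 0); apply: le_trans; exact: partial_cost_ge0.
Qed.

Lemma sum_stage_EFin x u :
  (fun N => \sum_(0 <= t < N) (quad Q (traj x u t) + quad Ru (u t))%:E)%E =
  EFin \o partial_cost x u.
Proof. by apply/funext => N; rewrite sumEFin. Qed.

Lemma has_cost_lqr x u c : has_cost x u c -> lqr_cost A B Q Ru x u = c%:E.
Proof.
move=> uc; rewrite /lqr_cost sum_stage_EFin; apply: cvg_lim => //.
by apply: cvg_EFin => //; near=> N.
Unshelve. all: by end_near. Qed.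

Lemma lqr_cost_has_cost x u :
  (lqr_cost A B Q Ru x u < +oo)%E -> exists c, has_cost x u c.
Proof.
move=> fin; have ge0 t : xpredT t -> (0 <= (stage_cost (traj x u t) (u t))%:E)%E.
  by move=> _; rewrite lee_fin stage_cost_ge0.
have cvg := @is_cvg_nneseries R _ xpredT 0 (fun t _ => ge0 t).
have := @nneseries_ge0 R _ xpredT 0 (fun t _ => ge0 t).
rewrite -/(lqr_cost A B Q Ru x u) => cost_ge0.
have cost_fin : lqr_cost A B Q Ru x u \is a fin_num.
  by rewrite ge0_fin_numE.
exists (fine (lqr_cost A B Q Ru x u)).
apply: (@fine_cvg _ _ _ _ (EFin \o partial_cost x u)).
by rewrite fineK // -sum_stage_EFin.
Qed.

Lemma solvable_optimal : lqr_solvable A B Q Ru ->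
  forall x, exists u c, optimal x u c.
Proof.
move=> solv x; have [u [/lqr_cost_has_cost[c uc] u0 umin]] := solv x.
exists u, c; split=> // v d v0 vd; have := umin v v0.
by rewrite (has_cost_lqr uc) (has_cost_lqr vd) lee_fin.
Qed.

(** * Linearity of trajectories and the parallelogram law for costs *)

Lemma trajD x y u w t :
  traj (x + y) (fun t => u t + w t) t = traj x u t + traj y w t.
Proof. by elim: t => //= t ->; rewrite !mulmxDr addrACA. Qed.

Lemma trajZ a x u t : traj (a *: x) (fun t => a *: u t) t = a *: traj x u t.
Proof. by elim: t => //= t ->; rewrite -!scalemxAr scalerDr. Qed.

Lemma trajB x y u w t :
  traj (x - y) (fun t => u t - w t) t = traj x u t - traj y w t.
Proof. by elim: t => //= t ->; rewrite !mulmxBr opprD addrACA. Qed.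

Lemma steersD x y u w : steers x u -> steers y w ->
  steers (x + y) (fun t => u t + w t).
Proof.
move=> ux wy; rewrite /steers_to_zero; under eq_fun do rewrite trajD.
by rewrite -(addr0 (0 : 'cV[R]_n)); exact: cvgD.
Qed.

Lemma steersB x y u w : steers x u -> steers y w ->
  steers (x - y) (fun t => u t - w t).
Proof.
move=> ux wy; rewrite /steers_to_zero; under eq_fun do rewrite trajB.
by rewrite -(subr0 (0 : 'cV[R]_n)); exact: cvgB.
Qed.

Lemma steersZ a x u : steers x u -> steers (a *: x) (fun t => a *: u t).
Proof.
move=> ux; rewrite /steers_to_zero; under eq_fun do rewrite trajZ.
by rewrite -(scaler0 _ a); exact: cvgZr.
Qed.

Lemma partial_costZ a x u N :
  partial_cost (a *: x) (fun t => a *: u t) N = a ^+ 2 * partial_cost x u N.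
Proof.
rewrite mulr_sumr; apply: eq_bigr => t _.
by rewrite trajZ /stage_cost !quadZ mulrDr.
Qed.

Lemma has_costZ a x u c : has_cost x u c ->
  has_cost (a *: x) (fun t => a *: u t) (a ^+ 2 * c).
Proof.
move=> uc; rewrite /has_cost; under eq_fun do rewrite partial_costZ.
exact: cvgMr.
Qed.

Lemma partial_cost_parallelogram x y u w N :
  partial_cost (x + y) (fun t => u t + w t) N +
  partial_cost (x - y) (fun t => u t - w t) N =
  2 * partial_cost x u N + 2 * partial_cost y w N.
Proof.
rewrite !mulr_sumr -!big_split /=; apply: eq_bigr => t _.
rewrite trajD trajB /stage_cost addrACA !quad_parallelogram.
by rewrite !mulrDr addrACA.
Qed.

(** Both partial costs on the left are nonnegative, so the finite identity bounds each by
    [2 * c + 2 * d], and monotone convergence gives the limits. *)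
Lemma has_cost_parallelogram x y u w c d : has_cost x u c -> has_cost y w d ->
  exists s r, [/\ has_cost (x + y) (fun t => u t + w t) s,
                  has_cost (x - y) (fun t => u t - w t) r &
                  s + r = 2 * c + 2 * d].
Proof.
move=> uc wd; have ub N : partial_cost (x + y) (fun t => u t + w t) N +
    partial_cost (x - y) (fun t => u t - w t) N <= 2 * c + 2 * d.
  rewrite partial_cost_parallelogram.
  by rewrite lerD// ler_pM2l// partial_cost_le.
have [s us] : exists s, has_cost (x + y) (fun t => u t + w t) s.
  apply: (bounded_has_cost (b := 2 * c + 2 * d)) => N.
  by apply: le_trans (ub N); rewrite lerDl partial_cost_ge0.
have [r ur] : exists r, has_cost (x - y) (fun t => u t - w t) r.
  apply: (bounded_has_cost (b := 2 * c + 2 * d)) => N.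
  by apply: le_trans (ub N); rewrite lerDr partial_cost_ge0.
exists s, r; split=> //.
rewrite -(cvg_lim _ (cvgD us ur))// -(cvg_lim _ (cvgD (cvgMr uc) (cvgMr wd)))//.
suff -> : partial_cost (x + y) (fun t => u t + w t) +
    partial_cost (x - y) (fun t => u t - w t) =
    2 \*o partial_cost x u + 2 \*o partial_cost y w by [].
by apply/funext => N; exact: partial_cost_parallelogram.
Qed.

Lemma optimalZ (a : R) x u c : a != 0 -> optimal x u c ->
  optimal (a *: x) (fun t => a *: u t) (a ^+ 2 * c).
Proof.
move=> a0 [uc u0 umin]; split; [exact: has_costZ|exact: steersZ|].
(* Rescaling by [a^-1] turns a competitor at [a *: x] into one at [x]. *)
move=> v d /(steersZ a^-1) + /(has_costZ (a := a^-1)).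
rewrite scalerA mulVf // scale1r => v0 vd; have := umin _ _ v0 vd.
by rewrite exprVn mulrC ler_pdivlMr ?exprn_even_gt0// mulrC.
Qed.

Lemma optimal0 : optimal 0 (fun=> 0) 0.
Proof.
have traj0 t : traj 0 (fun=> 0) t = 0 by elim: t => //= t ->; rewrite !mulmx0 addr0.
split=> [||v d _ /has_cost_ge0//].
  rewrite /has_cost (_ : partial_cost _ _ = fun=> 0); first exact: cvg_cst.
  apply/funext => N; apply: big1 => t _.
  by rewrite traj0 /stage_cost !quad0 addr0.
by rewrite /steers_to_zero; under eq_fun do rewrite traj0; exact: cvg_cst.
Qed.

(** * Linear optimal inputs and the quadratic value function *)

Context (solvable : forall x, exists u c, optimal x u c).

(* Averaging the optimal inputs at [x + y] and [x - y] gives competitors at [x]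
   and [y], so the parallelogram inequality for costs is an equality and forces
   [u + w] to be optimal. *)
Lemma optimalD x y u w c d : optimal x u c -> optimal y w d ->
  exists e, optimal (x + y) (fun t => u t + w t) e.
Proof.
move=> [uc u0 umin] [wd w0 wmin].
have [s [r [us ur srE]]] := has_cost_parallelogram uc wd.
have [v1 [e1 [v1e v10 v1min]]] := solvable (x + y).
have [v2 [e2 [v2e v20 v2min]]] := solvable (x - y).
have [s' [r' [us' ur' srE']]] := has_cost_parallelogram v1e v2e.
(* Half of [v1 + v2] steers [x] to zero at cost [s' / 4]. *)
have le_s' : 4 * c <= s'.
  have := steersZ 2^-1 (steersD v10 v20); have := has_costZ (a := 2^-1) us'.
  have -> : 2^-1 *: (x + y + (x - y)) = x.
    by rewrite addrACA subrr addr0 -mulr2n -[x *+ 2]scaler_nat scalerA mulVf ?scale1r.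
  by move=> cost0 steer0; have := umin _ _ steer0 cost0; lra.
have le_r' : 4 * d <= r'.
  have := steersZ 2^-1 (steersB v10 v20); have := has_costZ (a := 2^-1) ur'.
  have -> : 2^-1 *: (x + y - (x - y)) = y.
    rewrite opprB [x + y]addrC addrACA subrr addr0.
    by rewrite -mulr2n -[y *+ 2]scaler_nat scalerA mulVf ?scale1r.
  by move=> cost0 steer0; have := wmin _ _ steer0 cost0; lra.
have le_e2 := v2min _ _ (steersB u0 w0) ur.
have le_e1 := v1min _ _ (steersD u0 w0) us.
exists s; split=> //; first exact: steersD.
(* Since [s' + r' = 2 * e1 + 2 * e2], the two lower bounds give [e1 + e2 >= 2 * c + 2 * d = s + r];
   with [e2 <= r] this yields [s <= e1]. *)
by move=> v b v0 vb; apply: le_trans (v1min _ _ v0 vb); lra.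
Qed.

(** Column [j] of [G t] is the time-[t] value of an optimal input for the [j]-th basis vector;
    scaling and addition preserve optimality. *)
Lemma optimal_linear : exists G : nat -> 'M[R]_(m, n),
  forall x, exists c, optimal x (fun t => G t *m x) c.
Proof.
have [ue ueP] := choice (fun i : 'I_n => solvable (delta_mx i 0)).
exists (fun t => \matrix_(i, j) ue j t i 0) => x.
suff : exists c, optimal (\sum_i x i 0 *: delta_mx i 0)
   (fun t => \sum_i x i 0 *: ue i t) c.
  move=> [c]; have -> : \sum_i x i 0 *: delta_mx i 0 = x.
    apply/matrixP => i j; rewrite (ord1 j).
    rewrite summxE (bigD1 i)//= big1 ?addr0.
      by rewrite !mxE !eqxx mulr1.
    by move=> k ki; rewrite !mxE eq_sym (negbTE ki) mulr0.
  suff -> : (fun t => \sum_i x i 0 *: ue i t) =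
     (fun t => \matrix_(i, j) ue j t i 0 *m x) by exists c.
  apply/funext => t; apply/matrixP => i j; rewrite (ord1 j) summxE mxE.
  by apply: eq_bigr => k _; rewrite !mxE mulrC.
elim: (index_enum _) => [|i s [d IH]].
  exists 0; rewrite big_nil; under eq_fun do rewrite big_nil; exact: optimal0.
rewrite big_cons (_ : (fun t => \sum_(k <- i :: s) _) =
    fun t => x i 0 *: ue i t + \sum_(k <- s) x k 0 *: ue k t); last first.
  by apply/funext => t; rewrite big_cons.
(* [optimalZ] requires a nonzero factor, so a zero coefficient is dropped from the sum. *)
have [->|xi0] := eqVneq (x i 0) 0.
  exists d; rewrite scale0r add0r (_ : (fun t => _) =
      fun t => \sum_(k <- s) x k 0 *: ue k t) //.
  by apply/funext => t; rewrite scale0r add0r.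
have [ci iP] := ueP i.
exact: optimalD (optimalZ xi0 iP) IH.
Qed.

Lemma traj_linear (G : nat -> 'M[R]_(m, n)) : exists F : nat -> 'M[R]_n,
  forall x t, traj x (fun t => G t *m x) t = F t *m x.
Proof.
exists (fix F t := if t is s.+1 then A *m F s + B *m G s else 1%:M).
move=> x; elim=> [|t IH] /=; first by rewrite mul1mx.
by rewrite IH mulmxDl !mulmxA.
Qed.

(** With inputs linear in [x], the cost truncated at [N] is a quadratic form [S N]; its limit is
    [V]. *)
Lemma value_matrix : exists2 V : 'M[R]_n, V^T = V &
  forall x, exists u, optimal x u (quad V x).
Proof.
have [G Gopt] := optimal_linear; have [F FE] := traj_linear G.
pose S N := \sum_(0 <= t < N) ((F t)^T *m Q *m F t + (G t)^T *m Ru *m G t).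
have SE N x : quad (S N) x = partial_cost x (fun t => G t *m x) N.
  rewrite /partial_cost; elim: N => [|N IH].
    by rewrite /S !big_nil quad0m.
  rewrite /S !big_nat_recr //= quadDm IH; congr (_ + _).
  by rewrite quadDm !quad_mulmx FE.
have Ssym N : (S N)^T = S N.
  rewrite linear_sum; apply: eq_bigr => t _.
  by rewrite linearD /= !sym_mulmx //; [case: Ru_pd|case: Q_psd].
have Scost x c : has_cost x (fun t => G t *m x) c ->
    quad (S N) x @[N --> \oo] --> c.
  by rewrite /has_cost (_ : partial_cost x _ = fun N => quad (S N) x) //;
    apply/funext => N; rewrite SE.
have [x|V Vsym VE] := cvg_quad_limit Ssym.
  by have [c [/Scost xc _ _]] := Gopt x; apply/cvg_ex; exists c.
exists V => // x; have [c copt] := Gopt x; exists (fun t => G t *m x).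
suff -> : quad V x = c by [].
have [/Scost xc _ _] := copt.
by rewrite -(cvg_lim _ xc)// -(cvg_lim _ (VE x)).
Qed.

(** * Bellman's principle, the Riccati equation and the optimal gain *)

Lemma traj_shift x u t :
  traj x u t.+1 = traj (A *m x + B *m u 0%N) (fun t => u t.+1) t.
Proof. by elim: t => //= t <-. Qed.

Lemma partial_cost_shift x u N : partial_cost x u N.+1 =
  stage_cost x (u 0%N) +
  partial_cost (A *m x + B *m u 0%N) (fun t => u t.+1) N.
Proof.
rewrite /partial_cost big_nat_recl//; congr (_ + _).
by apply: eq_bigr => t _; rewrite traj_shift.
Qed.

Lemma has_cost_shift x u c :
  has_cost (A *m x + B *m u 0%N) (fun t => u t.+1) c <->
  has_cost x u (stage_cost x (u 0%N) + c).
Proof.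
rewrite /has_cost -[X in _ <-> X]cvg_shiftS /=.
set x' := A *m x + _; set u' := (fun t => u t.+1); set s := stage_cost _ _.
rewrite (_ : (fun N => partial_cost x u N.+1) =
             (fun N => s + partial_cost x' u' N)); last first.
  by apply/funext => N; rewrite partial_cost_shift.
split=> sc; first exact: (cvgD (cvg_cst s) sc).
rewrite -[c](addKr s) addrC (_ : partial_cost x' u' =
    fun N => s + partial_cost x' u' N - s); first exact: (cvgB sc (cvg_cst s)).
by apply/funext => N; rewrite addrAC subrr add0r.
Qed.

Lemma steers_shift x u :
  steers (A *m x + B *m u 0%N) (fun t => u t.+1) <-> steers x u.
Proof.
rewrite /steers_to_zero -[X in _ <-> X]cvg_shiftS.
rewrite /= (_ : (fun t => traj x u t.+1) =
  traj (A *m x + B *m u 0%N) (fun t => u t.+1)) //.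
by apply/funext => t; rewrite traj_shift.
Qed.

(** The gain satisfies [S *m K = - (B^T *m P *m A)], which absorbs the cross term in [v]; what
    remains is the Riccati operator. As [P] need not be a fixed point, this also serves to prove
    that [V] is one. *)
Lemma completion_of_squares (P : 'M[R]_n) x (v : 'cV[R]_m) :
  P^T = P -> Ru + B^T *m P *m B \in unitmx ->
  stage_cost x v + quad P (A *m x + B *m v) =
  quad (riccati A B Q Ru P) x +
  quad (Ru + B^T *m P *m B) (v - riccati_gain A B Ru P *m x).
Proof.
move=> Psym; set S := Ru + _ => Sunit.
have Rsym : Ru^T = Ru by case: Ru_pd.
have Ssym : S^T = S by rewrite linearD /= sym_mulmx // Rsym.
set K := riccati_gain A B Ru P.
have SK : S *m K = - (B^T *m P *m A).
  by rewrite mulmxN !mulmxA mulmxV // mul1mx.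
have vSKx : bform S v (K *m x) = - bform P (B *m v) (A *m x).
  rewrite -bform_mulmx /bform !mulmxA -(mulmxA v^T) SK.
  by rewrite mulmxN mulNmx mxE !mulmxA.
have KSK : K^T *m S *m K =
    A^T *m P *m B *m invmx S *m B^T *m P *m A.
  rewrite -mulmxA SK mulmxN /K /riccati_gain [(- _)^T]linearN /= mulNmx opprK !trmx_mul.
  by rewrite trmxK Psym trmx_inv Ssym !mulmxA.
have quadPN : quad (A^T *m P *m B *m invmx S *m B^T *m P *m A) x = quad S (K *m x).
  by rewrite -KSK quad_mulmx.
rewrite [quad S (_ - _)]quadD // -[- (K *m x)]scaleN1r quadZ bformZr vSKx.
rewrite /riccati quadDm quadBm quad_mulmx quadPN.
have -> : quad S v = quad Ru v + quad P (B *m v) by rewrite quadDm quad_mulmx.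
rewrite quadD // (bformC (A *m x) (B *m v) Psym) /stage_cost.
by ring.
Qed.

Lemma dare_of_value (V : 'M[R]_n) : V^T = V ->
  (forall x, exists u, optimal x u (quad V x)) -> dare_solution A B Q Ru V.
Proof.
move=> Vsym Vopt.
have Vpsd : psd V.
  by split=> // x; have [u [/has_cost_ge0]] := Vopt x.
have Sunit : Ru + B^T *m V *m B \in unitmx.
  by apply: posdef_unitmx; exact: posdef_addr.
have ricsym : (riccati A B Q Ru V)^T = riccati A B Q Ru V.
  rewrite /riccati; set S := Ru + _.
  have Ssym : S^T = S by rewrite linearD /= sym_mulmx //; case: Ru_pd => ->.
  rewrite !linearD /= linearN /= sym_mulmx //; congr (_ - _ + _); last by case: Q_psd.
  by rewrite !trmx_mul trmx_inv trmxK Ssym Vsym trmxK !mulmxA.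
split=> //; apply: sym_quad_inj => // x; apply/eqP; rewrite eq_le; apply/andP; split.
  (* Upper bound on [V]: apply the minimizing [v] first, then an optimal input from the successor
     state. *)
  set v := riccati_gain A B Ru V *m x.
  have := completion_of_squares x v Vsym Sunit.
  rewrite subrr quad0 addr0 => <-.
  have [u [uc u0 _]] := Vopt (A *m x + B *m v).
  have [_ [_ _ xmin]] := Vopt x.
  apply: (xmin (fun t => if t is s.+1 then u s else v)).
    exact/steers_shift.
  exact/(has_cost_shift x (fun t => if t is s.+1 then u s else v)).
(* Lower bound on [V]: the tail of an optimal input competes at the successor state, and the
   completed square is nonnegative. *)
have [u [uc u0 _]] := Vopt x.
have [_ [_ _ xmin]] := Vopt (A *m x + B *m u 0%N).
rewrite -(subrK (stage_cost x (u 0%N)) (quad V x)) addrC in uc.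
have := xmin _ _ (proj2 (steers_shift _ _) u0) (proj2 (has_cost_shift _ _ _) uc).
have := completion_of_squares x (u 0%N) Vsym Sunit.
have := posdef_quad_ge0 (u 0%N - riccati_gain A B Ru V *m x) (posdef_addr B Ru_pd Vpsd).
by lra.
Qed.

Lemma sum_completion_of_squares (P : 'M[R]_n) x u N :
  dare_solution A B Q Ru P ->
  partial_cost x u N + quad P (traj x u N) = quad P x +
  \sum_(0 <= t < N) quad (Ru + B^T *m P *m B)
     (u t - riccati_gain A B Ru P *m traj x u t).
Proof.
move=> [Psym Sunit PE]; elim: N => [|N IH].
  by rewrite /partial_cost !big_nil addrC.
rewrite partial_costS big_nat_recr //= [RHS]addrA -IH -[LHS]addrA -[RHS]addrA.
by rewrite completion_of_squares // -PE.
Qed.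

(** Stability of [A + B *m K] in trajectory form: the optimal input is itself the feedback [K], and
    it steers to zero. *)
Lemma optimal_gain_stabilizes K : optimal_gain A B Q Ru K ->
  forall x, exists u, steers x u /\ forall t, u t = K *m traj x u t.
Proof.
move=> [P [[Pdare Pmax] ->]] x.
have [V Vsym Vopt] := value_matrix.
have Vdare := dare_of_value Vsym Vopt.
have VP y : quad V y <= quad P y.
  by have [_ /(_ y)] := Pmax _ Vdare; rewrite quadBm subr_ge0.
have Ppsd : psd P.
  split=> [|y]; first by case: Pdare.
  by have [u [/has_cost_ge0 V0 _ _]] := Vopt y; apply: le_trans (VP y).
have [u [uc u0 _]] := Vopt x; exists u; split=> // t; apply/eqP.
rewrite -subr_eq0; apply/eqP.
apply: (posdef_quad_eq0 (posdef_addr B Ru_pd Ppsd)).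
(* As [partial_cost x u N <= quad V x <= quad P x], the square at time [t] is at most
   [quad P (traj x u N)] for all [N > t], which tends to 0. *)
have := cvg_quad (S := P) u0; rewrite quad0 => /cvgr_to_ge; apply.
near=> N.
have := sum_completion_of_squares x u N Pdare.
have tN : (t < N)%N by near: N; exact: nbhs_infty_gt.
rewrite big_mkord (bigD1 (Ordinal tN)) //=.
set s := \sum_(i < N | _) _.
have : 0 <= s by apply: sumr_ge0 => i _; exact/posdef_quad_ge0/posdef_addr.
have := VP x; have := partial_cost_le N uc.
by lra.
Unshelve. all: by end_near. Qed.

End lqr_optimality.

(** * Systems consistent with the data *)

Section informativity.
Context {R : realType} {n m q : nat} {T : 'I_q -> nat}.
Context {u : 'I_q -> nat -> 'cV[R]_m} {x : 'I_q -> nat -> 'cV[R]_n}.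
Implicit Types (A : 'M[R]_n) (B : 'M[R]_(n, m)) (K : 'M[R]_(m, n)).

Local Notation U := (Uminus T u).
Local Notation X := (Xminus T x).
Local Notation Xp := (Xplus T x).

Lemma Sigma_isE A B : Sigma_is T u x (A, B) <-> Xp = A *m X + B *m U.
Proof. by rewrite /Sigma_is /= mul_row_col. Qed.

Lemma generated_by_Sigma_is A B : generated_by T u x A B -> Sigma_is T u x (A, B).
Proof.
move=> gen; apply/Sigma_isE.
rewrite /Xminus /Uminus /Xplus !mul_mxrow -mxrowD; apply: eq_mxrow => i.
apply/matrixP => a t; rewrite !mxE gen // mxE !mxE.
by congr (_ + _); apply: eq_bigr => k _; rewrite mxE.
Qed.

(* A row annihilating the data but not [col_mx 1 K] could be added to a
   consistent system, changing its closed loop. *)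
Lemma gain_in_data_image A B K M : (0 < n)%N -> Sigma_is T u x (A, B) ->
  (forall A B, Sigma_is T u x (A, B) -> M = A + B *m K) ->
  exists Xd, X *m Xd = 1%:M /\ U *m Xd = K.
Proof.
move=> n_gt0 /Sigma_isE ABdata closed.
have MAB : M = A + B *m K by apply: closed; apply/Sigma_isE.
pose W := col_mx X U; pose G : 'M[R]_(n + m, n) := col_mx 1%:M K.
have annihilate (z : 'rV[R]_(n + m)) : z *m W = 0 -> z *m G = 0.
  (* All [n] rows of [Z] equal [z], so adding its two blocks to [A] and [B] keeps the system
     consistent. *)
  move=> zW0; pose Z : 'M[R]_(n, n + m) := \matrix_i z.
  have ZW0 : lsubmx Z *m X + rsubmx Z *m U = 0.
    rewrite -mul_row_col hsubmxK; apply/row_matrixP => i.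
    by rewrite row_mul rowK row0.
  have ZG0 : Z *m G = 0.
    rewrite -[Z]hsubmxK mul_row_col mulmx1.
    apply: (addrI M); rewrite addr0 {1}MAB addrACA -mulmxDl.
    apply/esym/closed/Sigma_isE.
    by rewrite !mulmxDl addrACA ZW0 addr0.
  have := congr1 (row (Ordinal n_gt0)) ZG0.
  by rewrite row_mul rowK row0.
(* By duality, the columns of [G] lie in the column span of [W]: each column of the cokernel of
   [W^T] transposes to a row annihilating [W]. *)
have /submxP[D GD] : (G^T <= W^T)%MS.
  rewrite submxE -trmx_eq0 trmx_mul trmxK; apply/eqP/row_matrixP => i.
  rewrite row_mul row0; apply: annihilate; rewrite -row_mul.
  by rewrite -{2}[W]trmxK -trmx_mul mulmx_coker trmx0 row0.
exists D^T; apply: eq_col_mx; rewrite -mul_col_mx.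
by rewrite -[LHS]trmxK trmx_mul trmxK -GD trmxK.
Qed.

(** This reads the matrix inequality as dissipation: at state [X *m v] with input [U *m v], [P]
    decreases in one step by at most the stage cost. *)
Lemma quad_lqr_lmi A B (Q : 'M[R]_n) (Ru : 'M[R]_m) (P : 'M[R]_n) v :
  Sigma_is T u x (A, B) ->
  quad (lqr_lmi T u x Q Ru P) v = quad P (X *m v) -
    quad P (A *m (X *m v) + B *m (U *m v)) - stage_cost Q Ru (X *m v) (U *m v).
Proof.
move/Sigma_isE=> XpE; rewrite /lqr_lmi !quadBm !quad_mulmx XpE mulmxDl.
by rewrite !mulmxA /stage_cost opprD addrA.
Qed.

Lemma lqr_lmi_sym (Q : 'M[R]_n) (Ru : 'M[R]_m) (P : 'M[R]_n) :
  Q^T = Q -> Ru^T = Ru -> P^T = P ->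
  (lqr_lmi T u x Q Ru P)^T = lqr_lmi T u x Q Ru P.
Proof.
move=> Qsym Rsym Psym.
by rewrite /lqr_lmi !linearB /= !sym_mulmx.
Qed.

(** Completing the squares at a Riccati solution leaves only the square of the deviation of the
    recorded inputs from the feedback. *)
Lemma lqr_lmi_dare A B (Q : 'M[R]_n) (Ru : 'M[R]_m) (P : 'M[R]_n) :
  psd Q -> posdef Ru -> psd P -> P = riccati A B Q Ru P ->
  Sigma_is T u x (A, B) ->
  let E := U - riccati_gain A B Ru P *m X in
  lqr_lmi T u x Q Ru P = - (E^T *m (Ru + B^T *m P *m B) *m E).
Proof.
move=> Qpsd Rpd Ppsd PE AB E.
have Spd := posdef_addr B Rpd Ppsd.
apply: sym_quad_inj.
- by apply: lqr_lmi_sym; [case: Qpsd|case: Rpd|case: Ppsd].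
- by rewrite linearN /= sym_mulmx //; case: Spd.
move=> v; rewrite (quad_lqr_lmi _ _ _ _ AB) [RHS]bformNm.
rewrite -[bform _ _ _]/(quad _ v) quad_mulmx.
rewrite mulmxBl -[_ *m X *m v]mulmxA.
have := completion_of_squares A Q Rpd (X *m v) (U *m v) (proj1 Ppsd)
  (posdef_unitmx Spd).
by rewrite -PE; lra.
Qed.

End informativity.

(** * Trace maximization and recovery of the gain *)

Theorem theorem29 (R : realType) (n m q : nat) (T : 'I_q -> nat)
    (n_gt0 : (0 < n)%N) (m_gt0 : (0 < m)%N) (q_gt0 : (0 < q)%N)
    (T_gt0 : forall i, (0 < T i)%N)
    (As : 'M[R]_n) (Bs : 'M[R]_(n, m))
    (u : 'I_q -> nat -> 'cV[R]_m) (x : 'I_q -> nat -> 'cV[R]_n)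
    (data_gen : generated_by T u x As Bs)
    (Q : 'M[R]_n) (Ru : 'M[R]_m) (Q_psd : psd Q) (Ru_pd : posdef Ru)
    (data_inf : informative_lqr T u x Q Ru)
    (K : 'M[R]_(m, n)) (K_opt : Sigma_is T u x `<=` Sigma_gain Q Ru K)
    (P : 'M[R]_n) (P_common : common_riccati T u x Q Ru K P) :
  unique (trace_maximizer T u x Q Ru) P /\
  (exists Xd : 'M[R]_(\sum_(i < q) T i, n),
     Xminus T x *m Xd = 1%:M /\ lqr_lmi T u x Q Ru P *m Xd = 0) /\
  (forall Xd : 'M[R]_(\sum_(i < q) T i, n),
     Xminus T x *m Xd = 1%:M -> lqr_lmi T u x Q Ru P *m Xd = 0 ->
     K = Uminus T u *m Xd).
Proof.
have ABs := generated_by_Sigma_is data_gen.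
have [Ppsd [M Mdata]] := P_common.
have [ME PE PME KE] := Mdata _ _ ABs.
have [/= /(solvable_optimal Q_psd Ru_pd) solv gain] := K_opt _ ABs.
have stable := optimal_gain_stabilizes Q_psd Ru_pd solv gain.
have closed A B : Sigma_is T u x (A, B) -> M = A + B *m K by case/Mdata.
have [Xd [XXd UXd]] := gain_in_data_image n_gt0 ABs closed.
have Spd := posdef_addr Bs Ru_pd Ppsd.
have LE := lqr_lmi_dare Q_psd Ru_pd Ppsd PE ABs.
rewrite -KE /= in LE.
set E := Uminus T u - _ in LE.
have Pfeas : lmi_feasible T u x Q Ru P.
  split=> //; rewrite /mxle sub0r LE opprK; split.
    by rewrite sym_mulmx //; case: Spd.
  by move=> v; rewrite quad_mulmx posdef_quad_ge0.
(* [P] dominates every feasible matrix in the semidefinite order, which is stronger than the trace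
   comparison. *)
have lmi_le P' : lmi_feasible T u x Q Ru P' -> psd (P - P').
  move=> [[P'sym P'ge0] [_ LP']]; set D := P - P'.
  have Dsym : D^T = D by rewrite linearB /= P'sym; case: Ppsd => ->.
  split=> // y.
  (* Test [L(P') <= 0] at [Xd *m z], where the state is [z] and the input [K *m z]; by [PME] the
     stage cost is the exact decrease of [P]. *)
  have Dstep z : quad D (M *m z) <= quad D z.
    have := LP' (Xd *m z); rewrite quadBm quad0m sub0r oppr_ge0.
    rewrite (quad_lqr_lmi _ _ _ _ ABs) !(mulmxA _ Xd z) XXd UXd mul1mx.
    rewrite (mulmxA Bs) -mulmxDl -ME.
    have : quad (P - M^T *m P *m M) z = quad (K^T *m Ru *m K + Q) z by rewrite PME.
    rewrite quadBm quadDm !quad_mulmx /stage_cost /D !quadBm.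
    by lra.
  (* [quad D] along the closed loop stays below [quad D y] and tends to 0, so [quad D y] is
     nonnegative. *)
  have [v [v0 vK]] := stable y.
  have Dtraj t : quad D (traj As Bs y v t) <= quad D y.
    elim: t => //= t; apply: le_trans.
    by rewrite vK mulmxA -mulmxDl -ME.
  have := cvg_quad (S := D) v0; rewrite quad0 => /cvgr_to_le; apply.
  by near=> t.
split; [split|split].
- split=> // P' /lmi_le/psd_trace_ge0; by rewrite linearB /= subr_ge0.
(* For another maximizer [P'], the positive semidefinite [P - P'] has trace at most 0 and so
   vanishes. *)
- move=> P' [P'feas /(_ _ Pfeas)]; rewrite -subr_le0 -linearB /=.
  by move/(psd_trace_eq0 (lmi_le _ P'feas))/eqP; rewrite subr_eq0 => /eqP.
- exists Xd; split=> //.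
  have EXd : E *m Xd = 0 by rewrite mulmxBl UXd -mulmxA XXd mulmx1 subrr.
  by rewrite LE mulNmx -(mulmxA _ E) EXd mulmx0 oppr0.
move=> Y XY LY; apply/esym/eqP; rewrite -subr_eq0.
have -> : Uminus T u *m Y - K = E *m Y by rewrite /E mulmxBl -mulmxA XY mulmx1.
(* The diagonal of this product holds the values of a positive definite form on the columns of
   [E *m Y], so these columns vanish. *)
have SEY : Y^T *m (E^T *m (Ru + Bs^T *m P *m Bs) *m E) *m Y = 0.
  by rewrite -[X in _ *m X *m _]opprK -LE mulmxN mulNmx -mulmxA LY mulmx0 oppr0.
apply/eqP/matrixP => i j.
have /posdef_quad_eq0 : posdef (Ru + Bs^T *m P *m Bs) := Spd.
move=> /(_ (col j (E *m Y))) EY0.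
have /EY0 /matrixP /(_ i 0) : quad (Ru + Bs^T *m P *m Bs) (col j (E *m Y)) <= 0.
  rewrite colE -(mulmxA E) -!quad_mulmx SEY.
  by rewrite quad0m.
by rewrite !mxE.
Unshelve. all: by end_near. Qed.
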